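(* Let $(G,+,\circ)$ be a skew left brace with cyclic additive group and abelian multiplicative group such that the number $s:=|G/\mathrm{Soc}(G)|$ is a nilpotent element of the ring $(G,+,* )$. Let $E$ be a trivial left semi-brace, $\alpha:(E,\circ)\to\mathrm{Aut}(G,+,\circ)$ a homomorphism and $B:=G\rtimes_\alpha E$ the semidirect product of left semi-braces. Then $B$ is a left nilpotent left cancellative left semi-brace.
   Context: A left semi-brace is a triple $(B,+,\circ)$ where $(B,+)$ is a semigroup, $(B,\circ)$ is a group and $a\circ(b+c)=a\circ b+a\circ(a^-+c)$ for all $a,b,c\in B$, where $a^-$ is the inverse of $a$ in $(B,\circ)$ and $\circ$ has higher precedence than $+$. It is left cancellative if $(B,+)$ is left cancellative. The neutral element of $(B,\circ)$ is denoted by $0$. Put $\lambda_a(b):=a\circ(a^-+b)$. A skew left brace is a left semi-brace for which $(B,+)$ is a group. The trivial left semi-brace on a group $(E,\circ)$ is given by $a+b:=b$. $\mathrm{Soc}(G)$ is the socle of the skew left brace $G$: the set of $a\in G$ such that $\lambda_a=\mathrm{id}_G$ and $a$ is central in $(G,+)$ (the latter is automatic when $(G,+)$ is abelian). Since $(G,+)$ is cyclic, it is identified with the additive group of $\mathbb{Z}/n\mathbb{Z}$ for some $n$, and $(G,+,* )$ is the ring $\mathbb{Z}/n\mathbb{Z}$, with $*$ the usual multiplication; the integer $s$ is regarded as an element of this ring. Semidirect product: $G\rtimes_\alpha E$ is the set $G\times E$ with $(g_1,e_1)+(g_2,e_2):=(g_1+g_2,e_1+e_2)=(g_1+g_2,e_2)$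 and $(g_1,e_1)\circ(g_2,e_2):=(g_1\circ\alpha_{e_1}(g_2),e_1\circ e_2)$; it is a left cancellative left semi-brace. Left nilpotency: for a left cancellative left semi-brace $B$, let $G_B:=B+0$ (a skew left brace, subgroup of $(B,\circ)$) and $E_B$ the set of idempotents of $(B,+)$. Put $a\cdot b:=\lambda_a(a^-)+a\circ b+\lambda_b(b^-)$, which lies in $G_B$, and for subsets $X,Y\subseteq B$ let $X\cdot Y$ be the additive subgroup of $(G_B,+)$ generated by the elements $a\cdot b$ with $a\in X$, $b\in Y$. Define $B^1:=B$ and $B^{n+1}:=B\cdot B^n+E_B$ for $n\geq 1$. $B$ is left nilpotent if $B^n=E_B$ for some $n\in\mathbb{N}$. *)

(* Defs.v *)
From HB Require Import structures.
From mathcomp Require Import all_boot all_algebra.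
From mathcomp Require Import boolp classical_sets functions cardinality.

Set Implicit Arguments.
Unset Strict Implicit.
Unset Printing Implicit Defensive.

Declare Scope lsb_scope.
Delimit Scope lsb_scope with lsb.
Local Open Scope classical_set_scope.
Local Open Scope group_scope.
Local Open Scope lsb_scope.

(* The circle operation is the multiplication of the underlying groupType, so
   its neutral element, called 0 in the literature, is 1%g here. *)
HB.mixin Record Group_isLeftSemiBrace B of Group B := {
  lsb_add : B -> B -> B;
  lsb_addA : associative lsb_add;
  lsb_mulD : forall a b c : B,
    a * lsb_add b c = lsb_add (a * b) (a * lsb_add a^-1 c)
}.

#[short(type="leftSemiBraceType")]
HB.structure Definition LeftSemiBrace := {B of Group_isLeftSemiBrace B & Group B}.

Notation "x + y" := (lsb_add x y) : lsb_scope.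

Section LeftSemiBraceTheory.
Context (B : leftSemiBraceType).
Implicit Types (a b : B) (X Y H I : set B).

Definition left_cancellative := forall a b c : B, a + b = a + c -> b = c.

Definition skew_left_brace := exists z : B,
  (forall a, z + a = a /\ a + z = a) /\
  (forall a, exists b, a + b = z /\ b + a = z).

Definition trivial_lsb := forall a b, a + b = b.

Definition lsb_lambda a b : B := a * (a^-1 + b).

Definition lsb_G : set B := [set b + 1 | b in setT].

Definition lsb_E : set B := [set e | e + e = e].

(* Subgroups of (B + 0, +), a group with neutral element 0 when B is left
   cancellative.  If B is a skew left brace then B + 0 = B. *)
Definition add_subgroup H := [/\ H `<=` lsb_G, H 1,
  (forall a b, H a -> H b -> H (a + b)) &
  (forall a, H a -> exists b, [/\ H b, a + b = 1 & b + a = 1])].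

Definition add_gen X : set B := smallest add_subgroup X.

Definition add_cyclic := exists g : B, add_gen [set g] = setT.

Definition lsb_dot a b : B :=
  lsb_lambda a a^-1 + a * b + lsb_lambda b b^-1.

Definition lsb_dots X Y : set B :=
  add_gen [set lsb_dot a b | a in X & b in Y].

(* lseries n is B^(n+1). *)
Fixpoint lseries (n : nat) : set B :=
  if n is m.+1 then [set x + e | x in lsb_dots setT (lseries m) & e in lsb_E]
  else setT.

Definition left_nilpotent := exists n, lseries n = lsb_E.

Definition lsb_soc : set B :=
  [set a | (forall b, lsb_lambda a b = b) /\ (forall b, a + b = b + a)].

(* The underlying set of the quotient by I, as the set of additive cosets
   a + I; for an ideal I of a skew left brace these are also the cosets of I
   in the multiplicative group. *)
Definition lsb_quot I : set (set B) :=
  range (fun a => [set a + x | x in I]).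

Record lsbAut := LsbAut {
  lsbAut_fun :> B -> B;
  lsbAut_bij : bijective lsbAut_fun;
  lsbAutD : {morph lsbAut_fun : a b / a + b};
  lsbAutM : {morph lsbAut_fun : a b / a * b}
}.

End LeftSemiBraceTheory.

Arguments left_cancellative : clear implicits.
Arguments skew_left_brace : clear implicits.
Arguments trivial_lsb : clear implicits.
Arguments lsb_G : clear implicits.
Arguments lsb_E : clear implicits.
Arguments add_cyclic : clear implicits.
Arguments lseries : clear implicits.
Arguments left_nilpotent : clear implicits.
Arguments lsb_soc : clear implicits.

(* Homomorphisms from the multiplicative group of E to the automorphism group
   of G, whose law is composition. *)
Record lsbAutHom (E : groupType) (G : leftSemiBraceType) := LsbAutHom {
  lsbAutHom_fun :> E -> lsbAut G;
  lsbAutHomM : forall (e f : E) (g : G),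
    lsbAutHom_fun (e * f) g = lsbAutHom_fun e (lsbAutHom_fun f g)
}.

Definition sdprod (G E : leftSemiBraceType) (alpha : lsbAutHom E G) : Type :=
  (G * E)%type.

Section SemidirectProduct.
Context (G E : leftSemiBraceType) (alpha : lsbAutHom E G).
Local Notation B := (sdprod alpha).

HB.instance Definition _ := Choice.copy B (G * E)%type.

Let add (x y : B) : B := (x.1 + y.1, x.2 + y.2).
Let mul (x y : B) : B := (x.1 * alpha x.2 y.1, x.2 * y.2).
Let one : B := (1, 1).
Let inv (x : B) : B := (alpha x.2^-1 x.1^-1, x.2^-1).

Let alpha1 g : alpha 1 g = g.
Proof. by apply: (bij_inj (lsbAut_bij (alpha 1))); rewrite -lsbAutHomM mulg1. Qed.

Let alpha_1 e : alpha e 1 = 1.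
Proof. by apply: (mulgI (alpha e 1)); rewrite -lsbAutM !mulg1. Qed.

Let mulA : associative mul.
Proof.
by move=> x y z; rewrite /mul /= lsbAutM lsbAutHomM !mulgA.
Qed.

Let mul1 : left_id one mul.
Proof. by case=> g e; rewrite /mul /= alpha1 !mul1g. Qed.

Let mulr1 : right_id one mul.
Proof. by case=> g e; rewrite /mul /= alpha_1 !mulg1. Qed.

Let mulV : left_inverse one inv mul.
Proof.
by case=> g e; rewrite /mul /inv /= -lsbAutM !mulVg alpha_1.
Qed.

Let mulrV : right_inverse one inv mul.
Proof.
by case=> g e; rewrite /mul /inv /= -lsbAutHomM !mulgV alpha1 mulgV.
Qed.

HB.instance Definition _ := isGroup.Build B mulA mul1 mulr1 mulV mulrV.

Let addA : associative add.
Proof. by move=> x y z; rewrite /add /= !lsb_addA. Qed.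

Let mulD (a b c : B) :
  mul a (add b c) = add (mul a b) (mul a (add (inv a) c)).
Proof.
case: a b c => [a e] [b f] [c h].
rewrite /add /mul /inv /= !lsbAutD -lsbAutHomM mulgV alpha1.
by congr pair; rewrite lsb_mulD.
Qed.

HB.instance Definition _ := Group_isLeftSemiBrace.Build B addA mulD.

End SemidirectProduct.

(* MathComp makes 'I_n.+2 a ring but not 'I_1.  The type 'I_n.+1 with the
   arithmetic modulo n.+1 is a ring for every n, the zero ring if n = 0. *)
Definition ZnZ (n : nat) : Type := 'I_n.+1.

HB.instance Definition _ (n : nat) := GRing.Zmodule.copy (ZnZ n) 'I_n.+1.
HB.instance Definition _ (n : nat) := GRing.Zmodule_isComPzRing.Build (ZnZ n)
  (@Zp_mulA n.+1) (@Zp_mulC n.+1) (@Zp_mul1z n) (@Zp_mul_addl n.+1).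

(* The ring Z/nZ for every natural number n; Z/0Z is the ring of integers. *)
Definition Zmod (n : nat) : comPzRingType := if n is m.+1 then ZnZ m else int.

(* Main.v *)
(* Identify (G, +) with Z/n; here n > 0, as s is nilpotent and nonzero.  Each
   lambda_a is multiplication by a unit, and commutativity of the circle forces
   a o b = a + b + c a b for a fixed c.  All elements 1 + c a are units, so c is
   nilpotent.  The socle is the annihilator of c, which is therefore generated
   by s.  An automorphism of G is multiplication by a unit v with c (v - 1) = 0,
   so s divides v - 1.  Hence every lambda_(a,e) - id on G is multiplication by
   a multiple of the nilpotent element r = gcd(s, c), and B^(k+1) has its first
   components in r^k Z/n. *)

Require Import Defs.
From mathcomp Require Import all_boot all_algebra.
From mathcomp Require Import boolp classical_sets functions cardinality.
Import GRing.Theory.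

Local Open Scope classical_set_scope.

(** * Arithmetic in the ring Z/(m+1) *)

Lemma ZnZ_natrE {m} i : val (i%:R%R : ZnZ m) = i %% m.+1.
Proof.
elim: i => [|i IHi]; first by rewrite mod0n.
by rewrite mulrS /= IHi modnDml modnDmr.
Qed.

Lemma ZnZ_natr_val {m} (x : ZnZ m) : ((val x)%:R = x)%R.
Proof. by apply: val_inj; rewrite ZnZ_natrE modn_small ?(ltn_ord x). Qed.

Lemma ZnZ_natr_eq0 m i : (i%:R = 0 :> ZnZ m)%R <-> m.+1 %| i.
Proof.
split=> [/(congr1 val)|]; first by rewrite ZnZ_natrE /= => /eqP.
by move=> /eqP i0; apply: val_inj; rewrite ZnZ_natrE i0.
Qed.

Lemma ZnZ_additive {m} {f : ZnZ m -> ZnZ m} :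
  {morph f : x y / x + y}%R -> forall x, f x = (f 1 * x)%R.
Proof.
move=> fD x; rewrite -[x]ZnZ_natr_val; elim: (val x) => [|i IHi].
  by apply: (addrI (f 0%R)); rewrite mulr0 !addr0 -fD addr0.
by rewrite mulrS fD IHi mulrDr mulr1.
Qed.

(* Among the powers of c two coincide, c ^ i = c ^ (i + d + 1), so that
   c ^ i (1 - c ^ (d + 1)) = 0, and 1 - c ^ (d + 1) has the form 1 + c a. *)
Lemma ZnZ_jacobson_nilpotent {m} (c : ZnZ m) :
  (forall a x : ZnZ m, (1 + c * a) * x = 0 -> x = 0)%R ->
  exists k, (c ^+ k = 0)%R.
Proof.
move=> reg; pose f (i : 'I_m.+2) : 'I_m.+1 := (c ^+ i)%R.
have /injectivePn[i [j neq_ij cij]] : ~~ injectiveb f.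
  apply/negP => /injectiveP /leq_card.
  by rewrite !card_ord ltnn.
wlog lt_ij : i j neq_ij cij / i < j.
  move=> wlog_ij; have [|] := ltnP i j; first exact: wlog_ij.
  rewrite leq_eqVlt => /predU1P[/val_inj eji|].
    by rewrite eji eqxx in neq_ij.
  by apply: wlog_ij => //; rewrite eq_sym.
exists i; apply: (reg (- c ^+ (j - i.+1))%R).
rewrite mulrN -exprS subnSK // mulrBl mul1r -exprD subnK ?(ltnW lt_ij) //.
by apply/eqP; rewrite subr_eq0; apply/eqP.
Qed.

Lemma coprime_div_gcdn a b :
  0 < gcdn a b -> coprime (a %/ gcdn a b) (b %/ gcdn a b).
Proof.
move=> d_gt0; rewrite /coprime -(eqn_pmul2r d_gt0) muln_gcdl mul1n.
by rewrite !divnK ?dvdn_gcdl ?dvdn_gcdr.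
Qed.

(** Dividing by a positive gcd leaves coprime numbers, whose powers are again coprime. *)
Lemma gcdnX a b k : gcdn (a ^ k) (b ^ k) = gcdn a b ^ k.
Proof.
have [d0|d_gt0] := posnP (gcdn a b).
  have /andP[/eqP-> /eqP->] : (a == 0) && (b == 0).
    by rewrite -[_ && _]negbK negb_and -!lt0n -gcdn_gt0 d0.
  by rewrite !gcdnn.
have /eqP co : coprime ((a %/ gcdn a b) ^ k) ((b %/ gcdn a b) ^ k).
  by rewrite coprimeXl ?coprimeXr ?coprime_div_gcdn.
rewrite -{1}(divnK (dvdn_gcdl a b)) -{3}(divnK (dvdn_gcdr a b)).
by rewrite !expnMn -muln_gcdl co mul1n.
Qed.

(** Cancelling the gcd of [m.+1] and [val c] in [m.+1 %| val c * i] leaves coprime numbers, so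
    Gauss's lemma applies. The number [t] will turn out to be the index of the socle. *)
Lemma ZnZ_annihilator {m} (c : ZnZ m) :
  exists2 t, 0 < t & forall i, (c * i%:R = 0)%R <-> t %| i.
Proof.
pose d := gcdn m.+1 (val c); have d_gt0 : 0 < d by rewrite gcdn_gt0.
exists (m.+1 %/ d) => [|i].
  by rewrite divn_gt0 // dvdn_leq ?dvdn_gcdl.
have -> : (c * i%:R = 0)%R <-> m.+1 %| val c * i.
  by rewrite -ZnZ_natr_eq0 natrM ZnZ_natr_val.
rewrite -{1}(divnK (dvdn_gcdl m.+1 (val c))) -/d.
rewrite -{1}(divnK (dvdn_gcdr m.+1 (val c))) -/d.
by rewrite mulnAC dvdn_pmul2r // Gauss_dvdr // coprime_div_gcdn.
Qed.

Lemma ZnZ_dvd {m r} {x : ZnZ m} :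
  r %| val x -> exists y : ZnZ m, (x = r%:R * y)%R.
Proof.
move=> /dvdnP[q xE]; exists (q%:R%R).
by rewrite -natrM mulnC -xE ZnZ_natr_val.
Qed.

(** The gcd of [s] and [val c] works: [m.+1] divides the powers of both with exponent [i + j], hence
    also the gcd of these powers, which is the same power of the gcd. *)
Lemma nilpotent_pair_generator {m s} {c : ZnZ m} :
  (exists i, s%:R ^+ i = 0 :> ZnZ m)%R -> (exists j, c ^+ j = 0)%R ->
  exists r, [/\ exists k, (r%:R ^+ k = 0 :> ZnZ m)%R, r %| s & r %| val c].
Proof.
move=> [i si] [j cj]; exists (gcdn s (val c)); split; last first.
- exact: dvdn_gcdr.
- exact: dvdn_gcdl.
exists (i + j); rewrite -natrX; apply/ZnZ_natr_eq0; rewrite -gcdnX dvdn_gcd.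
apply/andP; split; apply/ZnZ_natr_eq0; rewrite natrX.
  by rewrite exprD si mul0r.
by rewrite ZnZ_natr_val exprD cj mulr0.
Qed.

(** * Left semi-braces and their lambda maps *)

Local Open Scope group_scope.
Local Open Scope lsb_scope.

Lemma lsb_lambdaD (B : leftSemiBraceType) (a b c : B) :
  lsb_lambda a (b + c) = lsb_lambda a b + lsb_lambda a c.
Proof. by rewrite /lsb_lambda lsb_addA lsb_mulD. Qed.

Lemma skew_left_brace_cancellative (B : leftSemiBraceType) :
  skew_left_brace B -> left_cancellative B.
Proof.
move=> [z [z_neutral z_inv]] a b c eq_abc.
have [a' [_ a'a]] := z_inv a.
by rewrite -(z_neutral b).1 -(z_neutral c).1 -a'a -!lsb_addA eq_abc.
Qed.

Section LeftCancellative.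
Context {B : leftSemiBraceType} (addI : left_cancellative B).

(** The compatibility axiom for [1 * (1 + b)] reads [1 + b = 1 + (1 + b)]. *)
Lemma lsb_add1 (b : B) : 1 + b = b.
Proof.
by apply: (addI 1); rewrite -[RHS]mul1g lsb_mulD invg1 !mul1g.
Qed.

Lemma lsb_mulE (a b : B) : a * b = a + lsb_lambda a b.
Proof. by rewrite -[b in LHS]lsb_add1 lsb_mulD mulg1. Qed.

Lemma lsb_lambda_inj (a : B) : injective (lsb_lambda a).
Proof. by move=> b c eq_bc; apply: (mulgI a); rewrite !lsb_mulE eq_bc. Qed.

End LeftCancellative.

(** * Skew left braces with additive group Z/(m+1) *)

Section CyclicSkewBrace.
Context {G : leftSemiBraceType} {m : nat} {phi : G -> ZnZ m} {psi : ZnZ m -> G}.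
Hypotheses (phiK : cancel phi psi) (psiK : cancel psi phi).
Hypothesis phiD : {morph phi : a b / a + b >-> (a + b)%R}.

Let addI : left_cancellative G.
Proof.
by move=> a b c /(congr1 phi); rewrite !phiD => /addrI/(can_inj phiK).
Qed.

Let phi_inj := can_inj phiK.

Lemma phi1 : phi 1 = 0%R.
Proof. by apply: (addrI (phi 1)); rewrite -phiD lsb_add1 // addr0. Qed.

(** Each lambda_a is additive, hence multiplication by [u a 1]. Commuting [a] with the generator
    [psi 1] expresses [u a 1] through [u (psi 1) 1], and [c] is the latter minus 1. *)
Lemma cyclic_mulE : commutative (fun a b : G => a * b) ->
  exists c : ZnZ m, forall a b : G,
    phi (a * b) = (phi a + phi b + c * phi a * phi b)%R.
Proof.
move=> mulC; pose u a x := phi (lsb_lambda a (psi x)).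
have uE a x : u a x = (u a 1 * x)%R.
  apply: ZnZ_additive x => x y.
  rewrite /u -phiD -lsb_lambdaD; congr (phi (lsb_lambda _ _)).
  by apply: phi_inj; rewrite phiD !psiK.
have mulE a b : phi (a * b) = (phi a + u a 1 * phi b)%R.
  by rewrite lsb_mulE // phiD -uE /u phiK.
exists (u (psi 1%R) 1 - 1)%R => a b.
have ua : (phi a + u a 1 = 1 + u (psi 1) 1 * phi a)%R.
  by rewrite -[u a 1%R]mulr1 -{2}[1%R]psiK -mulE (mulC a) mulE psiK.
rewrite mulE; have -> : u a 1%R = (1 + (u (psi 1) 1 - 1) * phi a)%R.
  apply: (addrI (phi a)).
  by rewrite ua mulrBl mul1r addrCA (addrC (phi a)) subrK.
by rewrite mulrDl mul1r addrA.
Qed.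

Context {c : ZnZ m}.
Hypothesis phiM : forall a b : G,
  phi (a * b) = (phi a + phi b + c * phi a * phi b)%R.

Lemma phi_lambda a b : phi (lsb_lambda a b) = ((1 + c * phi a) * phi b)%R.
Proof.
by apply: (addrI (phi a)); rewrite -phiD -lsb_mulE // phiM mulrDl mul1r addrA.
Qed.

(** [1 + c * a] is the multiplier of the injective map lambda at [psi a], hence not a zero
    divisor. *)
Lemma cyclic_coef_nilpotent : exists k, (c ^+ k = 0)%R.
Proof.
apply: ZnZ_jacobson_nilpotent => a x cax0.
rewrite -[x]psiK -phi1; congr phi; apply: (lsb_lambda_inj addI (psi a)).
by apply: phi_inj; rewrite !phi_lambda !psiK cax0 phi1 mulr0.
Qed.

Lemma cyclic_socE a : lsb_soc G a <-> (c * phi a = 0)%R.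
Proof.
split=> [[/(_ (psi 1%R))/(congr1 phi)]|ca0].
  rewrite phi_lambda psiK mulr1 => c1 _.
  by apply: (addrI 1%R); rewrite c1 addr0.
split=> b; apply: phi_inj; last by rewrite !phiD addrC.
by rewrite phi_lambda ca0 addr0 mul1r.
Qed.

(** The socle is the kernel of the additive map sending [a] to [c * phi a], and its cosets are the
    fibres. *)
Lemma cyclic_cosetE a b :
  [set a + x | x in lsb_soc G] = [set b + x | x in lsb_soc G] <->
  (c * phi a = c * phi b)%R.
Proof.
have cosetE d x : [set d + y | y in lsb_soc G] x <-> (c * phi x = c * phi d)%R.
  split=> [[y /cyclic_socE cy0 <-]|cxd]; first by rewrite phiD mulrDr cy0 addr0.
  exists (psi (phi x - phi d)%R).
    by apply/cyclic_socE; rewrite psiK mulrBr cxd subrr.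
  by apply: phi_inj; rewrite phiD psiK addrC subrK.
split=> [eq_ab|eq_cab].
  by apply/(cosetE b); rewrite -eq_ab; apply/cosetE.
by apply/seteqP; split=> x /cosetE cx; apply/cosetE; rewrite cx.
Qed.

(** With [t] from [ZnZ_annihilator], the residues below [t] represent each coset of the socle
    exactly once, so [s = t]. *)
Lemma cyclic_index_soc {s} : (lsb_quot (lsb_soc G) #= `I_s)%card ->
  forall i, (c * i%:R = 0)%R <-> s %| i.
Proof.
move=> s_card; have [t t_gt0 tP] := ZnZ_annihilator c.
pose f i := [set psi i%:R%R + y | y in lsb_soc G].
have fE : lsb_quot (lsb_soc G) = f @` `I_t.
  apply/seteqP; split=> [_ [a _ <-]|_ [i _ <-]]; last by exists (psi i%:R%R).
  exists (val (phi a) %% t); first by rewrite /= ltn_mod.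
  apply/cyclic_cosetE; rewrite psiK -[in RHS](ZnZ_natr_val (phi a)).
  rewrite [in RHS](divn_eq (val (phi a)) t) natrD mulrDr.
  by rewrite ((tP _).2 (dvdn_mull _ _)) ?add0r.
have f_le i j : i <= j -> j < t -> f i = f j -> i = j.
  move=> le_ij lt_jt /cyclic_cosetE; rewrite !psiK => /esym/eqP.
  rewrite -subr_eq0 -mulrBr -natrB // => /eqP/tP t_dvd.
  apply/eqP; rewrite eqn_leq le_ij -subn_eq0; apply: contraLR t_dvd => ij_neq0.
  by rewrite gtnNdvd ?lt0n // (leq_ltn_trans (leq_subr _ _)).
have f_inj : {in `I_t &, injective f}.
  move=> i j; rewrite !inE /= => lt_it lt_jt eq_f.
  have [le_ij|/ltnW le_ji] := leqP i j; first exact: f_le.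
  by apply/esym/f_le.
suff -> : s = t by [].
apply/card_eq_II; apply: card_eq_trans (inj_card_eq f_inj).
by rewrite -fE card_eq_sym.
Qed.

(** Applying [theta] to the circle square of [psi 1] gives [c * v * v = c * v]; surjectivity of
    [theta] makes [v] a unit, which cancels. *)
Lemma cyclic_autE (theta : lsbAut G) :
  exists2 v : ZnZ m, (c * (v - 1) = 0)%R &
    forall a, phi (theta a) = (v * phi a)%R.
Proof.
pose f x := phi (theta (psi x)); pose v := f 1%R.
have thetaE a : phi (theta a) = (v * phi a)%R.
  rewrite -[a in LHS]phiK; apply: (ZnZ_additive (f := f)) => x y.
  rewrite /f -phiD -lsbAutD; congr (phi (theta _)).
  by apply: phi_inj; rewrite phiD !psiK.
exists v => //.
have [theta' _ thetaK] := lsbAut_bij theta.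
have cvv : (c * v * v = c * v)%R.
  have := thetaE (psi 1%R * psi 1%R).
  rewrite lsbAutM !phiM !thetaE !psiK !mulr1.
  by rewrite !mulrDr !mulr1 => /addrI ->; rewrite mulrC.
have vu : (v * phi (theta' (psi 1%R)) = 1)%R by rewrite -thetaE thetaK psiK.
by rewrite mulrBr mulr1 -[LHS]mulr1 -vu mulrA mulrBl cvv subrr mul0r.
Qed.

Lemma cyclic_uniform_nilpotency {s} :
  (lsb_quot (lsb_soc G) #= `I_s)%card ->
  (exists k, s%:R ^+ k = 0 :> ZnZ m)%R ->
  exists2 r : ZnZ m, (exists k, r ^+ k = 0)%R &
    forall a (theta : lsbAut G) b, exists y : ZnZ m,
      phi (lsb_lambda a (theta b)) = (phi b + r * y * phi b)%R.
Proof.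
move=> s_card s_nilpotent.
have [r [r_nil r_s r_c]] :=
  nilpotent_pair_generator s_nilpotent cyclic_coef_nilpotent.
exists (r%:R)%R => // a theta b.
have [v cv1 thetaE] := cyclic_autE theta.
have [y1 cE] := ZnZ_dvd r_c.
have [y2 vE] : exists y : ZnZ m, (v - 1 = r%:R * y)%R.
  apply/ZnZ_dvd/(dvdn_trans r_s); apply/(cyclic_index_soc s_card).
  by rewrite ZnZ_natr_val.
(* The multiplier minus 1 is [(1 + c * phi a) * v - 1 = (v - 1) + c * phi a * v], and [r] divides
   both terms. *)
exists (y2 + y1 * phi a * v)%R.
have {}vE : v = (1 + r%:R * y2)%R by rewrite -vE addrC subrK.
rewrite phi_lambda thetaE mulrDl mul1r mulrDr mulrDl !mulrA -cE addrA.
by rewrite {1}vE mulrDl mul1r.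
Qed.

End CyclicSkewBrace.

(** * The semidirect product with a trivial left semi-brace *)

Section TrivialSemidirectProduct.
Context {G E : leftSemiBraceType} {alpha : lsbAutHom E G}.
Hypothesis Etrivial : trivial_lsb E.
Local Notation B := (sdprod alpha).

Lemma sdprod_left_cancellative : left_cancellative G -> left_cancellative B.
Proof.
move=> addI [a e] [b f] [d h] [/addI -> ].
by rewrite !Etrivial => ->.
Qed.

Lemma lsbAutHomKV (e : E) : cancel (alpha e^-1) (alpha e).
Proof.
move=> g; apply: (bij_inj (lsbAut_bij (alpha 1))).
by rewrite -!lsbAutHomM mul1g mulgV.
Qed.

(** The inverse of [x] is twisted by [alpha x.2^-1], and the product with [x] undoes this twist. *)
Lemma sdprod_lambda1 (x y : B) :
  (lsb_lambda x y).1 = lsb_lambda x.1 (alpha x.2 y.1).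
Proof. by rewrite /lsb_lambda -(lsbAutHomKV x.2 x.1^-1) -lsbAutD. Qed.

Lemma sdprod_lambda_inv1 (x : B) :
  (lsb_lambda x x^-1).1 = lsb_lambda x.1 x.1^-1.
Proof. by rewrite sdprod_lambda1 lsbAutHomKV. Qed.

Lemma sdprod_dot1 (x y : B) :
  (lsb_dot x y).1 =
  lsb_lambda x.1 x.1^-1 + x.1 * alpha x.2 y.1 + lsb_lambda y.1 y.1^-1.
Proof. by rewrite -!sdprod_lambda_inv1. Qed.

Lemma sdprod_dot2 (x y : B) : (lsb_dot x y).2 = 1.
Proof. by rewrite /= !Etrivial mulgV. Qed.

Context {m : nat} {phi : G -> ZnZ m} {psi : ZnZ m -> G}.
Hypotheses (phiK : cancel phi psi) (psiK : cancel psi phi).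
Hypothesis phiD : {morph phi : a b / a + b >-> (a + b)%R}.
Let phi_inj := can_inj phiK.
Let addI : left_cancellative G.
Proof. by move=> a b c /(congr1 phi); rewrite !phiD => /addrI/phi_inj. Qed.

Context {r : ZnZ m}.
Hypothesis lambdaE : forall a (theta : lsbAut G) b, exists y : ZnZ m,
  phi (lsb_lambda a (theta b)) = (phi b + r * y * phi b)%R.

Let phi1 : phi 1 = 0%R.
Proof. exact: phi1 phiK phiD. Qed.

Let addr1 (a : G) : a + 1 = a.
Proof. by apply: phi_inj; rewrite phiD phi1 addr0. Qed.

Lemma sdprod_E (x : B) : lsb_E B x <-> phi x.1 = 0%R.
Proof.
case: x => a e /=; split=> [[aa _]|a0].
  by apply: (addrI (phi a)); rewrite -phiD aa addr0.
by congr pair => //; apply: phi_inj; rewrite phiD a0 addr0.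
Qed.

Lemma phi_lambdaV a : phi (lsb_lambda a a^-1) = (- phi a)%R.
Proof.
by apply: (addrI (phi a)); rewrite -phiD -lsb_mulE // mulgV subrr phi1.
Qed.

(** As [lsb_lambda a a^-1] is the additive inverse of [a], the dot product measures how far lambda
    composed with [alpha x.2] moves [y.1]. *)
Lemma phi_sdprod_dot (x y : B) :
  exists z : ZnZ m, phi (lsb_dot x y).1 = (r * z * phi y.1)%R.
Proof.
have [z zE] := lambdaE x.1 (alpha x.2) y.1; exists z.
rewrite sdprod_dot1 lsb_mulE // !phiD !phi_lambdaV zE addKr.
by rewrite addrC addKr.
Qed.

Lemma sdprod_lseries_sub k :
  lseries B k `<=` [set x | exists y, phi x.1 = r ^+ k * y]%R.
Proof.
elim: k => [|k IHk]; first by move=> x _; exists (phi x.1); rewrite expr0 mul1r.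
(* Dot products have second component 1. Each gains a factor [r], so the subgroup [H] contains all
   generators. *)
pose H := [set x : B | x.2 = 1%g /\ exists y, phi x.1 = r ^+ k.+1 * y]%R.
have H_subgroup : add_subgroup H.
  split.
  - move=> [a e] [/= -> _]; exists (a, 1) => //.
    by congr pair; rewrite ?addr1.
  - split=> //; exists 0%R; rewrite mulr0 phi1 //.
  - move=> [a e] [b f] [/= -> [y yE]] [/= -> [z zE]].
    split; first exact: Etrivial.
    by exists (y + z)%R; rewrite phiD yE zE mulrDr.
  - move=> [a e] [/= -> [y yE]]; exists (psi (- phi a)%R, 1%g); split.
    + split=> //; exists (- y)%R; rewrite psiK yE mulrN //.
    + by congr pair => //; apply: phi_inj; rewrite phiD psiK subrr phi1.
    + by congr pair => //; apply: phi_inj; rewrite phiD psiK addNr phi1.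
move=> _ [x x_dots [e eE <-]].
have [_ [y yE]] : H x.
  apply: (smallest_sub H_subgroup) x_dots => _ [a _ [b /IHk[y yE] <-]].
  split; first exact: sdprod_dot2.
  have [z ->] := phi_sdprod_dot a b; exists (z * y)%R.
  by rewrite yE exprS -!mulrA (mulrCA z).
by exists y; rewrite phiD yE (sdprod_E e).1 ?addr0.
Qed.

Lemma sdprod_left_nilpotent : (exists k, r ^+ k = 0)%R -> left_nilpotent B.
Proof.
move=> [k rk0]; exists k; apply/seteqP; split=> [x /sdprod_lseries_sub|x].
  rewrite /= rk0 => -[y].
  by rewrite mul0r => x0; apply/sdprod_E.
(* Conversely, an idempotent [x] is [1 + x], and 1 lies in every additive subgroup. *)
move=> xE; case: k {rk0} => [//|k]; exists 1.
  by move=> H [[]].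
exists x => //; apply: lsb_add1.
exact: sdprod_left_cancellative.
Qed.

End TrivialSemidirectProduct.

Theorem proposition6p5
  (G : leftSemiBraceType)
  (Gskew : skew_left_brace G)
  (Gcyclic : add_cyclic G)
  (Gabelian : commutative (fun a b : G => (a * b)%g))
  (n : nat) (phi : G -> Zmod n)
  (phi_bij : bijective phi)
  (phiD : {morph phi : a b / (a + b)%lsb >-> (a + b)%R})
  (s : nat)
  (s_card : (lsb_quot (lsb_soc G) #= `I_s)%card)
  (s_nilpotent : exists k : nat, (s%:R ^+ k = 0 :> Zmod n)%R)
  (E : leftSemiBraceType)
  (Etrivial : trivial_lsb E)
  (alpha : lsbAutHom E G) :
  left_cancellative (sdprod alpha) /\ left_nilpotent (sdprod alpha).
Proof.
split; first exact/sdprod_left_cancellative/skew_left_brace_cancellative.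
case: n => [|m] in phi phi_bij phiD s_nilpotent *.
  (* Over the integers a nilpotent [s] is 0, yet the quotient contains the coset of 1. *)
  have [k] := s_nilpotent.
  move=> /eqP; rewrite expf_eq0 Num.Theory.pnatr_eq0 => /andP[_ /eqP s0].
  move: s_card; rewrite s0 II0 card_eq0 => /eqP quot0.
  have : lsb_quot (lsb_soc G) [set (1 + x)%lsb | x in lsb_soc G] by exists 1.
  by rewrite quot0.
have [psi phiK psiK] := phi_bij.
have [c phiM] := cyclic_mulE phiK psiK phiD Gabelian.
have [r r_nil lambdaE] :=
  cyclic_uniform_nilpotency phiK psiK phiD phiM s_card s_nilpotent.
exact: (sdprod_left_nilpotent Etrivial phiK psiK phiD lambdaE).
Qed.
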